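(* Let $r,p,s,n$ be positive integers such that $p\mid r$, $s\mid r$ and $ps\mid rn$. Then, as formal power series in $t,q$, $$\bigg\{\sum_{k\geq 0}t^k[k+1]^n_q\bigg\}_{q^p}=\frac{\sum_{g\in G(r,p,s,n)}t^{\mathrm{fdes}(g)}q^{\mathrm{fmaj}(g)}}{(1-t)(1-t^rq^r)(1-t^rq^{2r})\cdots(1-t^rq^{(n-1)r})(1-t^{\frac{r}{s}}q^{\frac{nr}{s}})}.$$
   Context: Notation. For a positive integer $m$, $R_m(i)\in\{0,\ldots,m-1\}$ denotes the residue of $i\in\mathbb Z$ modulo $m$. $[m]_x=1+x+\cdots+x^{m-1}$. For a power series $F$, $\{F\}_{q^p}$ is obtained from $F$ by discarding all terms whose degree in $q$ is not divisible by $p$. Groups. $G(r,n)$ is the group of pairs $(c_1,\ldots,c_n;\sigma)$ with $c_i\in\{0,\ldots,r-1\}$ (the colors) and $\sigma\in S_n$, with product $(d_1,\ldots,d_n;\tau)(c_1,\ldots,c_n;\sigma)=(R_r(c_1+d_{\sigma(1)}),\ldots,R_r(c_n+d_{\sigma(n)});\tau\sigma)$. For $p\mid r$, $G(r,p,n)$ is the subgroup of elements with $c_1+\cdots+c_n\equiv 0 \bmod p$. For $s\mid r$ with $ps\mid rn$, $C_s\subseteq G(r,p,n)$ is the cyclic subgroup of order $s$ generated by $(r/s,\ldots,r/s;\mathrm{id})$, and $G(r,p,s,n)=G(r,p,n)/C_s$. Statistics. For $g\in G(r,p,s,n)$ represented by $(c_1,\ldots,c_n;\sigma)$ let $\mathrm{HDes}(g)=\{i\in\{1,\ldots,n-1\}: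 c_i=c_{i+1},\ \sigma(i)>\sigma(i+1)\}$, $h_i(g)=\#\{j\ge i: j\in\mathrm{HDes}(g)\}$, $k_n(g)=R_{r/s}(c_n)$, $k_i(g)=k_{i+1}(g)+R_r(c_i-c_{i+1})$ for $1\le i\le n-1$, $\lambda_i(g)=r\,h_i(g)+k_i(g)$. Then $\mathrm{fmaj}(g)=\sum_{i=1}^n\lambda_i(g)$ and $\mathrm{fdes}(g)=\lambda_1(g)$. These do not depend on the representative chosen. *)

(* Defs.v *)
From HB Require Import structures.
From mathcomp Require Import all_boot all_order all_algebra all_fingroup.
From mathcomp Require Import boolp.

Set Implicit Arguments.
Unset Strict Implicit.
Unset Printing Implicit Defensive.

Import GRing.Theory.

Local Open Scope ring_scope.

(* Formal power series over R; [F i] is the coefficient of degree i. Equality *)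
(* is decided classically.                                                    *)
Record fps (R : Type) := FPS { coefs :> nat -> R }.

HB.instance Definition _ (R : Type) := gen_eqMixin (fps R).
HB.instance Definition _ (R : Type) := gen_choiceMixin (fps R).

Lemma fpsP (R : Type) (F G : fps R) : F =1 G -> F = G.
Proof. by case: F G => [f] [g] /= /funext ->. Qed.

Section Ring.
Variable R : comNzRingType.
Implicit Types F G H : fps R.

Definition fps0 : fps R := FPS (fun=> 0).
Definition fps_opp F : fps R := FPS (fun i => - F i).
Definition fps_add F G : fps R := FPS (fun i => F i + G i).
Definition fps1 : fps R := FPS (fun i => (i == 0%N)%:R).
Definition fps_mul F G : fps R :=
  FPS (fun i => \sum_(j < i.+1) F j * G (i - j)%N).

Fact fps_addA : associative fps_add.
Proof. by move=> F G H; apply: fpsP => i /=; rewrite addrA. Qed.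
Fact fps_addC : commutative fps_add.
Proof. by move=> F G; apply: fpsP => i /=; rewrite addrC. Qed.
Fact fps_add0 : left_id fps0 fps_add.
Proof. by move=> F; apply: fpsP => i /=; rewrite add0r. Qed.
Fact fps_addN : left_inverse fps0 fps_opp fps_add.
Proof. by move=> F; apply: fpsP => i /=; rewrite addNr. Qed.

HB.instance Definition _ :=
  GRing.isZmodule.Build (fps R) fps_addA fps_addC fps_add0 fps_addN.

Fact fps_mulC : commutative fps_mul.
Proof.
move=> F G; apply: fpsP => i /=.
rewrite (reindex_inj rev_ord_inj) /=; apply: eq_bigr => j _.
by rewrite subSS subKn -1?ltnS // mulrC.
Qed.

(* The low coefficients of a product are those of a product of polynomials.   *)
Lemma fps_mul_trunc F G N i : (i < N)%N ->
  fps_mul F G i = ((\poly_(k < N) F k) * (\poly_(k < N) G k))`_i.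
Proof.
move=> iN; rewrite coefM /=; apply: eq_bigr => j _; rewrite !coef_poly.
have jN : (j < N)%N by apply: leq_ltn_trans iN; rewrite -ltnS.
by rewrite jN (leq_ltn_trans (leq_subr _ _) iN).
Qed.

Fact fps_mulA : associative fps_mul.
Proof.
move=> F G H; apply: fpsP => i /=.
pose P (K : fps R) := \poly_(k < i.+1) K k.
transitivity ((P F * (P G * P H))`_i).
  rewrite coefM; apply: eq_bigr => j _.
  by rewrite coef_poly ltn_ord -fps_mul_trunc // ltnS leq_subr.
rewrite mulrA coefM; apply: eq_bigr => j _.
by rewrite [(P H)`_ _]coef_poly ltnS leq_subr -fps_mul_trunc.
Qed.

Fact fps_mul1 : left_id fps1 fps_mul.
Proof.
move=> F; apply: fpsP => i /=; rewrite big_ord_recl /= mul1r subn0 big1 ?addr0 //.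
by move=> j _; rewrite mul0r.
Qed.

Fact fps_mulDl : left_distributive fps_mul fps_add.
Proof.
move=> F G H; apply: fpsP => i /=; rewrite -big_split /=.
by apply: eq_bigr => j _; rewrite mulrDl.
Qed.

Fact fps1_neq0 : fps1 != fps0.
Proof.
by apply/eqP => /(congr1 (fun F : fps R => F 0%N)) /eqP; rewrite /= oner_eq0.
Qed.

HB.instance Definition _ := GRing.Zmodule_isComNzRing.Build (fps R)
  fps_mulA fps_mulC fps_mul1 fps_mulDl fps1_neq0.

Lemma coef_fps0 i : (0 : fps R) i = 0. Proof. by []. Qed.
Lemma coef_fps1 i : (1 : fps R) i = (i == 0%N)%:R. Proof. by []. Qed.
Lemma coef_fpsD F G i : (F + G) i = F i + G i. Proof. by []. Qed.
Lemma coef_fpsN F i : (- F) i = - F i. Proof. by []. Qed.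
Lemma coef_fpsM F G i : (F * G) i = \sum_(j < i.+1) F j * G (i - j)%N.
Proof. by []. Qed.

Definition fpsC (a : R) : fps R := FPS (fun i => if i == 0%N then a else 0).
Definition fpsX : fps R := FPS (fun i => (i == 1%N)%:R).

Lemma coef_fpsCM a F i : (fpsC a * F) i = a * F i.
Proof.
by rewrite coef_fpsM big_ord_recl /= subn0 big1 ?addr0 // => j _; rewrite mul0r.
Qed.

Lemma coef_fpsXM F i : (fpsX * F) i = if i is j.+1 then F j else 0.
Proof.
rewrite coef_fpsM big_ord_recl /= mul0r add0r; case: i => [|i].
  by rewrite big_ord0.
rewrite big_ord_recl /= mul1r subSS subn0 big1 ?addr0 // => j _.
by rewrite mul0r.
Qed.

Lemma coef_fpsXnM k F i :
  (fpsX ^+ k * F) i = if (k <= i)%N then F (i - k)%N else 0.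
Proof.
elim: k i => [|k IHk] i; first by rewrite expr0 mul1r subn0.
by rewrite exprS -mulrA coef_fpsXM; case: i => // i; rewrite IHk subSS.
Qed.

End Ring.

Section Inverse.
Variable R : comUnitRingType.
Implicit Types F G : fps R.

(* The first n coefficients of 1 / F.                                         *)
Fixpoint fps_inv_seq F n : seq R :=
  if n is m.+1 then
    let s := fps_inv_seq F m in
    rcons s ((F 0%N)^-1 * ((m == 0%N)%:R - \sum_(i < m) s`_i * F (m - i)%N))
  else [::].

Definition fps_unit : pred (fps R) := fun F => F 0%N \is a GRing.unit.
Definition fps_inv F : fps R :=
  if fps_unit F then FPS (fun i => (fps_inv_seq F i.+1)`_i) else F.

Lemma size_fps_inv_seq F n : size (fps_inv_seq F n) = n.
Proof. by elim: n => //= n IHn; rewrite size_rcons IHn. Qed.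

Lemma nth_fps_inv_seq F n i : (i < n)%N ->
  (fps_inv_seq F n)`_i = (fps_inv_seq F i.+1)`_i.
Proof.
elim: n => // n IHn; rewrite ltnS leq_eqVlt => /predU1P[-> // | ltin].
by rewrite [in LHS]/= nth_rcons size_fps_inv_seq ltin IHn.
Qed.

Fact fps_mulVr : {in fps_unit, left_inverse 1 fps_inv *%R}.
Proof.
move=> F; rewrite -[F \in _]/(fps_unit F) => uF; apply: fpsP => n.
rewrite coef_fpsM coef_fps1 /fps_inv uF big_ord_recr subnn.
have -> : \sum_(i < n) FPS (fun k => (fps_inv_seq F k.+1)`_k) i * F (n - i)%N
        = \sum_(i < n) (fps_inv_seq F n)`_i * F (n - i)%N.
  apply: eq_bigr => i _.
  by rewrite (nth_fps_inv_seq F (ltn_ord i)).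
rewrite /= nth_rcons size_fps_inv_seq ltnn eqxx mulrAC mulVr // mul1r.
by rewrite addrC subrK.
Qed.

Fact fps_unitP F G : G * F = 1 -> fps_unit F.
Proof.
move=> /(congr1 (fun H : fps R => H 0%N)).
rewrite coef_fpsM big_ord1 coef_fps1 /= => GF1.
by apply/unitrPr; exists (G 0%N); rewrite mulrC.
Qed.

Fact fps_inv_out : {in [predC fps_unit], fps_inv =1 id}.
Proof. by move=> F nuF; rewrite /fps_inv ifN. Qed.

HB.instance Definition _ := GRing.ComNzRing_hasMulInverse.Build (fps R)
  fps_mulVr fps_unitP fps_inv_out.

Lemma unit_fpsE F : (F \is a GRing.unit) = (F 0%N \is a GRing.unit).
Proof. by []. Qed.

End Inverse.

Arguments coefs : simpl never.

(* Power series in t and q with integer coefficients, as power series in t    *)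
(* over Z[[q]]: [F i j] is the coefficient of t^i q^j.                        *)
Notation fps_tq := (fps (fps int)).

Definition t_ : fps_tq := fpsX (fps int).
Definition q_ : fps_tq := fpsC (fpsX int).

Lemma unit_1_sub_t (a : nat) (F : fps_tq) :
  (0 < a)%N -> 1 - t_ ^+ a * F \is a GRing.unit.
Proof.
move=> a_gt0; rewrite unit_fpsE coef_fpsD coef_fpsN coef_fpsXnM leqNgt a_gt0.
by rewrite subr0 coef_fps1 unitr1.
Qed.

(* The infinite sum of the t^k a_k.                                           *)
Definition tseries (a : nat -> fps int) : fps_tq := FPS a.

Lemma tseries_partial (a : nat -> fps int) (N i : nat) : (i < N)%N ->
  tseries a i = (\sum_(k < N) t_ ^+ k * fpsC (a k)) i.
Proof.
move=> iN; have coef_sum (I : finType) (F : I -> fps_tq) j :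
    (\sum_k F k) j = \sum_k F k j.
  by elim/big_rec2: _ => [|k G H _ <-]; [exact: coef_fps0 | exact: coef_fpsD].
rewrite coef_sum (bigD1 (Ordinal iN)) //= coef_fpsXnM leqnn subnn big1 ?addr0 //.
move=> k ki; rewrite coef_fpsXnM; case: leqP => // leki.
rewrite /coefs /= subn_eq0; case: leqP => // leik.
by case/eqP: ki; apply: val_inj; apply/eqP; rewrite eqn_leq leki.
Qed.

Definition qbracket (m : nat) : fps int := \sum_(i < m) fpsX int ^+ i.

(* {F}_{q^p}                                                                  *)
Definition qpart (p : nat) (F : fps_tq) : fps_tq :=
  FPS (fun i => FPS (fun j => if (p %| j)%N then F i j else 0)).

(* The colors {0, ..., r-1} are the elements of Z/rZ, for r > 0: addition in  *)
(* 'I_r.-1.+1 is addition modulo r. This spelling also covers r = 1.          *)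
Record Gr (r n : nat) :=
  ColPerm { clr : {ffun 'I_n -> 'I_r.-1.+1}; prm : 'S_n }.

Definition Gr_pair r n (g : Gr r n) := (clr g, prm g).
Definition pair_Gr r n u : Gr r n := ColPerm u.1 u.2.
Lemma Gr_pairK r n : cancel (@Gr_pair r n) (@pair_Gr r n).
Proof. by case. Qed.

HB.instance Definition _ r n :=
  Finite.copy (Gr r n) (can_type (@Gr_pairK r n)).

Section Group.
Variables r n : nat.
Implicit Types g h : Gr r n.

Lemma GrP g h : clr g =1 clr h -> prm g = prm h -> g = h.
Proof. by case: g h => [c u] [d v] /= /ffunP-> ->. Qed.

(* The permutation component of a product g * h is prm g composed after       *)
(* prm h, which for permutations is the product (prm h * prm g)%g.            *)
Definition Gr_mul g h : Gr r n :=
  ColPerm [ffun i => clr h i + clr g (prm h i)] (prm h * prm g)%g.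
Definition Gr_one : Gr r n := ColPerm [ffun=> 0] 1%g.
Definition Gr_inv g : Gr r n :=
  ColPerm [ffun i => - clr g ((prm g)^-1 i)%g] (prm g)^-1%g.

Fact Gr_mulA : associative Gr_mul.
Proof.
by move=> g h k; apply: GrP => [i|] /=; rewrite ?mulgA // !ffunE permM addrA.
Qed.
Fact Gr_mul1 : left_id Gr_one Gr_mul.
Proof. by move=> g; apply: GrP => [i|] /=; rewrite ?mulg1 // !ffunE addr0. Qed.
Fact Gr_mulV : left_inverse Gr_one Gr_inv Gr_mul.
Proof.
by move=> g; apply: GrP => [i|] /=; rewrite ?mulgV // !ffunE permK addrN.
Qed.

HB.instance Definition _ :=
  Finite_isGroup.Build (Gr r n) Gr_mulA Gr_mul1 Gr_mulV.

End Group.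

(* Meaningful for p dividing r, in which case it is a subgroup.               *)
Definition Grp (r p n : nat) : {set Gr r n} :=
  [set g | (p %| \sum_i clr g i)%N].

Definition scalar_elt (r s n : nat) : Gr r n :=
  ColPerm [ffun=> inZp (r %/ s)%N] 1%g.
Definition Cs (r s n : nat) : {group Gr r n} := <[scalar_elt r s n]>%G.

Definition Grps (r p s n : nat) : {set coset_of (Cs r s n)} :=
  (Grp r p n / Cs r s n)%g.

Lemma Grp_group_set (r p n : nat) : (0 < r)%N -> (p %| r)%N ->
  group_set (Grp r p n).
Proof.
move=> r0 pr; apply/group_setP; split=> [|g h]; rewrite !inE.
  by rewrite big1 // => i _; rewrite ffunE.
move=> pg ph; rewrite (reindex_perm (prm h)) /= in pg.
suff: (\sum_i clr (g * h)%g i = \sum_i (clr h i + clr g (prm h i)) %[mod p])%N.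
  by rewrite big_split /dvdn => -> /=; rewrite -/(dvdn _ _) dvdn_add.
have pr' : (p %| r.-1.+1)%N by rewrite prednK.
elim/big_rec2: _ => // i a b _ eqab; rewrite ffunE /=.
by rewrite -modnDmr eqab modnDmr -modnDml (modn_dvdm _ pr') modnDml.
Qed.

Lemma scalar_eltX (r s n m : nat) : (scalar_elt r s n ^+ m)%g =
  ColPerm [ffun=> inZp (m * (r %/ s))] 1%g.
Proof.
elim: m => [|m IHm].
  by apply: GrP => [i|] //=; rewrite !ffunE; apply: val_inj; rewrite /= mod0n.
rewrite expgS IHm; apply: GrP => [i|] /=; last by rewrite mulg1.
by rewrite !ffunE; apply: val_inj; rewrite /= modnDm mulSn addnC.
Qed.

Lemma Cs_sub_Grp (r p s n : nat) : (0 < r)%N -> (0 < s)%N -> (p %| r)%N ->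
  (s %| r)%N -> (p * s %| r * n)%N -> Cs r s n \subset Grp r p n.
Proof.
move=> r0 s0 pr sr psrn; have pr' : (p %| r.-1.+1)%N by rewrite prednK.
rewrite -[Grp _ _ _]/(group (Grp_group_set n r0 pr) : {set _}) cycle_subG /= inE.
under eq_bigr do rewrite ffunE /=.
rewrite sum_nat_const card_ord /dvdn -modnMmr (modn_dvdm _ pr') modnMmr.
by rewrite -/(dvdn _ _) -(dvdn_pmul2r s0) -mulnA divnK // [(n * r)%N]mulnC.
Qed.

Lemma Cs_central (r s n : nat) : (Cs r s n \subset 'C([set: Gr r n]))%g.
Proof.
rewrite cycle_subG; apply/centP => h _; rewrite /commute.
apply: GrP => [i|]; last by rewrite /= mulg1 mul1g.
by rewrite /= !ffunE /= perm1 addrC.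
Qed.

(* R_m(i)                                                                     *)
Definition residue (m : nat) (i : int) : nat := `|(i %% m)%Z|%N.

(* Positions are numbered from 0: the paper's h_i, k_i and lambda_i are       *)
(* [h_stat _ i.-1], [k_stat _ _ i.-1] and [lambda_stat _ _ i.-1].             *)
Section Statistics.
Variables (r s n : nat).
Implicit Type g : Gr r n.

Definition HDes g : {set 'I_n} :=
  [set i : 'I_n | [exists j : 'I_n,
    [&& (j == i.+1 :> nat)%N, clr g i == clr g j & (prm g j < prm g i)%N]]].

Definition h_stat g (i : nat) : nat := #|[set j in HDes g | (i <= j)%N]|.

(* k_i depends only on the colors c_i, ..., c_n.                              *)
Fixpoint k_seq (cs : seq nat) : nat :=
  match cs with
  | [::] => 0
  | c :: cs' =>
      if cs' is c' :: _ then (k_seq cs' + residue r (c%:Z - c'%:Z))%N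
      else residue (r %/ s)%N c
  end.

Definition colors g : seq nat := [seq clr g i : nat | i <- enum 'I_n].

Definition k_stat g (i : nat) : nat := k_seq (drop i (colors g)).

Definition lambda_stat g (i : nat) : nat := (r * h_stat g i + k_stat g i)%N.

Definition fmaj_rep g : nat := (\sum_(i < n) lambda_stat g i)%N.
Definition fdes_rep g : nat := lambda_stat g 0.

Definition fmaj (x : coset_of (Cs r s n)) : nat := fmaj_rep (repr x).
Definition fdes (x : coset_of (Cs r s n)) : nat := fdes_rep (repr x).

Lemma size_colors g : size (colors g) = n.
Proof. by rewrite /colors size_map size_enum_ord. Qed.

Lemma nth_colors g (i : 'I_n) : nth 0%N (colors g) i = clr g i.
Proof. by rewrite (nth_map i) ?size_enum_ord // nth_ord_enum. Qed.

Lemma k_stat_last g (i : 'I_n) : i.+1 = n ->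
  k_stat g i = residue (r %/ s) (clr g i : nat)%:Z.
Proof.
move=> ni; rewrite /k_stat (drop_nth 0%N) ?size_colors //.
by rewrite drop_oversize ?size_colors ?ni // nth_colors.
Qed.

Lemma k_stat_rec g (i j : 'I_n) : j = i.+1 :> nat ->
  k_stat g i =
    (k_stat g j + residue r ((clr g i : nat)%:Z - (clr g j : nat)%:Z))%N.
Proof.
move=> ji; rewrite /k_stat (drop_nth 0%N) ?size_colors // -ji.
rewrite [drop j _](drop_nth 0%N) ?size_colors //.
by rewrite !nth_colors.
Qed.

Lemma residue_eq (m : nat) (i j : int) :
  (i = j %[mod m])%Z -> residue m i = residue m j.
Proof. by rewrite /residue => ->. Qed.

Lemma k_seq_shift m cs : (s %| r)%N ->
  k_seq [seq ((c + m * (r %/ s)) %% r)%N | c <- cs] = k_seq cs.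
Proof.
move=> s_r; elim: cs => [//|c [_|c' cs IH]].
  have rs_r : (r %/ s %| r)%N by apply/dvdnP; exists s; rewrite mulnC divnK.
  by apply: residue_eq; rewrite !modz_nat (modn_dvdm _ rs_r) addnC modnMDl.
rewrite /= in IH *; rewrite {}IH; congr (_ + _)%N; apply: residue_eq.
rewrite -!modz_nat modzDml -modzDmr modzNm modzDmr !PoszD.
by rewrite opprD addrACA subrr addr0.
Qed.

Lemma lambda_stat_Cs g (z : Gr r n) i : (0 < r)%N -> (s %| r)%N ->
  z \in Cs r s n -> lambda_stat (z * g)%g i = lambda_stat g i.
Proof.
move=> r_gt0 s_r /cycleP[m ->]; rewrite scalar_eltX.
set z' := ColPerm _ _; rewrite /lambda_stat; congr (_ * _ + _)%N.
  suff eqH : HDes (z' * g)%g = HDes g by rewrite /h_stat eqH.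
  apply/setP => j; rewrite !inE; apply: eq_existsb => k.
  by rewrite /= !ffunE !permM !perm1 (can_eq (addrK _)).
rewrite /k_stat -(k_seq_shift m (drop i (colors g)) s_r) map_drop.
suff -> : colors (z' * g)%g =
  [seq ((c + m * (r %/ s)) %% r)%N | c <- colors g] by [].
rewrite /colors -[RHS]map_comp; apply: eq_map => j /=.
by rewrite !ffunE /= modnDmr; congr (_ %% _)%N; rewrite prednK.
Qed.

(* The statistics can be computed on any representative.                      *)
Lemma fmaj_fdesE (x : coset_of (Cs r s n)) g : (0 < r)%N -> (s %| r)%N ->
  g \in set_of_coset x -> fmaj x = fmaj_rep g /\ fdes x = fdes_rep g.
Proof.
move=> r_gt0 s_r; have [y Ny ->] := cosetP x; rewrite val_coset // => gx.
have lam i : lambda_stat (repr (coset (Cs r s n) y)) i = lambda_stat g i.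
  have: repr (coset (Cs r s n) y) \in (Cs r s n :* y)%g.
    by rewrite -val_coset // mem_repr_coset.
  case/rcosetP: gx => a aC -> /rcosetP[b bC ->].
  by rewrite !lambda_stat_Cs.
by split; [apply: eq_bigr => i _|]; apply: lam.
Qed.

End Statistics.

(* Main.v *)
(* Put x_i = t q^i. Sorting a sequence f : {1..n} -> {0..k} into decreasing   *)
(* order by a unique permutation (ties broken by position) and summing over   *)
(* the sorted sequences gives Carlitz's identity, the case r = p = s = 1.     *)
(* For s = 1 put d_i = lambda_i - lambda_(i+1), with d_n = lambda_n, so that  *)
(* the weight of g is the product of the x_i^(d_i). For a fixed permutation,  *)
(* d_i is the representative of c_i - c_(i+1) modulo r in {0..r-1}, or in     *)
(* {1..r} at a descent, and these differences determine the colors. Summing   *)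
(* over the colors thus multiplies each factor of the Carlitz numerator by    *)
(* 1 + x_i + .. + x_i^(r-1) = (1 - x_i^r) / (1 - x_i). As fmaj is congruent   *)
(* to the sum of the colors modulo p, extracting the powers of q^p restricts  *)
(* the sum to G(r,p,n). Finally, the s elements of a coset of C_s have the    *)
(* weights w y^a with 0 <= a < s, y = t^(r/s) q^(nr/s) and w the weight of    *)
(* the coset, which changes the last factor 1 - y^s into 1 - y.               *)

(* All identities are proved with the denominators multiplied out; division comes only at the end.
   [tseries_chain_sum] sums over chains with prescribed gaps, by substituting t q for t. By
   [sorts_is_chain] the sequences sorted by a given permutation are the chains whose gaps mark its
   descents; hence [carlitz]. Since [color_diff] is a bijection, the color differences are free
   parameters, and geometric sums lead from [carlitz] to [sum_Gr_series]. Extraction of the powers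
   of q^p is linear over series in q^p ([qpartM]), so it acts on the numerator alone
   ([qpart_series]). On a coset of C_s, [level] takes each value below s once, which splits off the
   factor 1 + y + .. + y^(s-1) in [sum_Grps]. *)
From HB Require Import structures.
Require Import Defs.
From mathcomp Require Import all_boot all_order all_algebra all_fingroup.

Set Implicit Arguments.
Unset Strict Implicit.
Unset Printing Implicit Defensive.

Import GRing.Theory.

Local Open Scope ring_scope.

(** * Sums over chains *)

Lemma coef_fps_sum (R : comNzRingType) I (r : seq I) (P : pred I)
    (F : I -> fps R) j :
  (\sum_(i <- r | P i) F i) j = \sum_(i <- r | P i) F i j.
Proof.
by elim/big_rec2: _ => [|i G H _ <-]; [exact: coef_fps0 | exact: coef_fpsD].
Qed.

Lemma tseries_sum I (r : seq I) (P : pred I) (u : I -> nat -> fps int) :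
  tseries (fun k => \sum_(i <- r | P i) u i k) =
  \sum_(i <- r | P i) tseries (u i).
Proof. by apply: fpsP => k; rewrite coef_fps_sum. Qed.

Lemma geom_sum (R : comNzRingType) (x : R) n :
  (1 - x) * \sum_(i < n) x ^+ i = 1 - x ^+ n.
Proof. by apply: oppr_inj; rewrite -mulNr !opprB subrX1. Qed.

(* The substitution of t q for t. *)
Definition tshift (F : fps_tq) : fps_tq := FPS (fun k => fpsX int ^+ k * F k).

Fact tshift_zmod_morphism : zmod_morphism tshift.
Proof.
by move=> F G; apply: fpsP => k; rewrite /coefs /= -mulrBr.
Qed.
HB.instance Definition _ :=
  GRing.isZmodMorphism.Build fps_tq fps_tq tshift tshift_zmod_morphism.

Fact tshift_monoid_morphism : monoid_morphism tshift.
Proof.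
split=> [|F G]; apply: fpsP => k.
  rewrite /coefs /= -/(coefs _ _) coef_fps1.
  by case: k => [|k]; rewrite ?mulr0 ?mul1r ?expr0.
rewrite [LHS]/coefs /= !coef_fpsM mulr_sumr; apply: eq_bigr => j _.
by rewrite /coefs /= mulrACA -exprD subnKC // -ltnS.
Qed.
HB.instance Definition _ :=
  GRing.isMonoidMorphism.Build fps_tq fps_tq tshift tshift_monoid_morphism.

Lemma tshift_t : tshift t_ = t_ * q_.
Proof.
apply: fpsP => k; rewrite mulrC coef_fpsCM [LHS]/coefs /= /t_ [in RHS]/coefs /=.
by case: k => [|[|k]]; rewrite ?mulr0 // /coefs /=.
Qed.

Lemma tshift_q : tshift q_ = q_.
Proof.
apply: fpsP => k; rewrite /coefs /=.
by case: k => [|k]; rewrite /coefs /= ?expr0 ?mul1r ?mulr0.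
Qed.

(** Multiplication by [1 - t_] takes successive differences of coefficients. For k < d the truncated
    subtraction leaves an empty sum, which accounts for the shift by [t_ ^+ d]. *)
Lemma tseries_partial_sums (u : nat -> fps int) d :
  (1 - t_) * tseries (fun k => \sum_(x < k.+1 - d) u x) = t_ ^+ d * tseries u.
Proof.
apply: fpsP => k; rewrite mulrBl mul1r coef_fpsD coef_fpsN.
rewrite coef_fpsXM coef_fpsXnM [X in X - _]/coefs /=.
case: k => [|k]; first by case: d => [|d]; rewrite ?big_ord1 ?big_ord0 subr0.
rewrite /coefs /=; case: leqP => [le_dk|lt_kd].
  by rewrite (subSn le_dk) big_ord_recr /= addrAC subrr add0r.
have /eqP-> : (k.+2 - d == 0)%N by rewrite subn_eq0.
have /eqP-> : (k.+1 - d == 0)%N by rewrite subn_eq0 ltnW.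
by rewrite !big_ord0 subr0.
Qed.

(* [chain_sum [:: d_1; ..; d_n] a_0] is the sum of q^(a_1 + .. + a_n) over *)
(* the sequences such that a_i + d_i <= a_(i-1).                              *)
Fixpoint chain_sum (ds : seq nat) (k : nat) : fps int :=
  if ds is d :: ds' then
    \sum_(x < k.+1 - d) fpsX int ^+ x * chain_sum ds' x
  else 1.

(** The sum over the first entry x contributes t^d / (1 - t), and its weight q^x amounts to
    replacing t by t q in the series of the tail, which raises every index of the induction
    hypothesis by one. *)
Lemma tseries_chain_sum ds :
  tseries (chain_sum ds) * \prod_(i < (size ds).+1) (1 - t_ * q_ ^+ i) =
  \prod_(i < size ds) (t_ * q_ ^+ i) ^+ nth 0%N ds i.
Proof.
elim: ds => [|d ds IH] /=.
  rewrite big_ord1 big_ord0 expr0 mulr1 mulrC mulrBl mul1r.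
  by apply: fpsP => -[|k]; rewrite coef_fpsD coef_fpsN coef_fpsXM ?subr0 ?subrr.
rewrite big_ord_recl [RHS]big_ord_recl /= expr0 mulr1 mulrA [_ * (1 - t_)]mulrC.
rewrite (tseries_partial_sums (fun x => fpsX int ^+ x * chain_sum ds x)).
rewrite -mulrA; congr (_ * _).
have := congr1 tshift IH; rewrite rmorphM !rmorph_prod /=.
have tq i : tshift (t_ * q_ ^+ i) = t_ * q_ ^+ i.+1.
  by rewrite rmorphM rmorphXn /= tshift_t tshift_q -mulrA -exprS.
under eq_bigr do rewrite rmorphB rmorph1 /= tq.
under [in RHS]eq_bigr do rewrite rmorphXn /= tq.
by [].
Qed.

Fixpoint is_chain (ds : seq nat) (k : nat) (s : seq nat) : bool :=
  match ds, s with
  | d :: ds', x :: s' => (x + d <= k)%N && is_chain ds' x s'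
  | _, _ => true
  end.

Lemma is_chainP ds k s : size ds = size s ->
  reflect (forall i, (i < size s)%N ->
             (nth 0 s i + nth 0 ds i <= nth 0 (k :: s) i)%N)
          (is_chain ds k s).
Proof.
elim: ds k s => [|d ds IH] k [|x s] //= => [_|[/IH{}IH]]; first by left.
apply: (iffP andP) => [[le_xk /IH chs] [|i]|chs] //; first exact: chs.
by split; [exact: (chs 0) | apply/IH => i ?; exact: (chs i.+1)].
Qed.

Lemma sum_ffun_recl (T : finType) (V : nmodType) n
    (P : pred {ffun 'I_n.+1 -> T})
    (F : {ffun 'I_n.+1 -> T} -> V)
    (cons := fun x (a : {ffun 'I_n -> T}) =>
               [ffun i => if unlift ord0 i is Some j then a j else x]) :
  \sum_(a | P a) F a = \sum_x \sum_(a | P (cons x a)) F (cons x a).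
Proof.
rewrite pair_big_dep /= (reindex (fun u => cons u.1 u.2)) //=.
exists (fun a : {ffun 'I_n.+1 -> T} => (a ord0, [ffun i => a (lift ord0 i)])).
  move=> [x a] _; congr (_, _); first by rewrite ffunE unlift_none.
  by apply/ffunP => i; rewrite !ffunE liftK.
move=> a _; apply/ffunP => i; rewrite ffunE /=.
by case: unliftP => [j|] ->; rewrite ?ffunE.
Qed.

(** The entries of a chain never exceed k, so one fixed range ['I_N] serves throughout the
    induction, while the bound k drops to x. *)
Lemma chain_sumE N n ds k : (k < N)%N -> size ds = n ->
  chain_sum ds k =
  \sum_(a : {ffun 'I_n -> 'I_N} |
        is_chain ds k [seq a i : nat | i <- enum 'I_n])
     \prod_i fpsX int ^+ a i.
Proof.
elim: n ds k => [|n IH] [|d ds] k //= ltkN => [_ | [sz]].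
  rewrite (eq_bigl predT) => [|a].
    rewrite (eq_bigr (fun=> 1)) => [|a _]; last by rewrite big_ord0.
    by rewrite sumr_const [X in _ *+ X]card_ffun !card_ord.
  by [].
rewrite (@sum_ffun_recl 'I_N).
have mapE x (a : {ffun 'I_n -> 'I_N})
    (b := [ffun i => if unlift ord0 i is Some j then a j else x]) :
  [seq b i : nat | i <- enum 'I_n.+1] =
  (x : nat) :: [seq a i : nat | i <- enum 'I_n].
  rewrite enum_ordSl /= ffunE unlift_none -map_comp; congr (_ :: _).
  by apply: eq_map => i /=; rewrite ffunE liftK.
transitivity (\sum_(x < N | (x < k.+1 - d)%N) fpsX int ^+ x * chain_sum ds x).
  rewrite [RHS](big_ord_narrow (leq_trans (leq_subr d k.+1) ltkN)).
  by [].
rewrite big_mkcond; apply: eq_bigr => x _.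
have -> : (x < k.+1 - d)%N = (x + d <= k)%N by rewrite ltn_subRL addnC.
case: ifP => [le_xk|nle_xk]; last first.
  by rewrite big_pred0 // => a; rewrite mapE /= nle_xk.
rewrite (IH ds x) // mulr_sumr; apply: eq_big => [a|a _].
  by rewrite mapE /= le_xk.
rewrite big_ord_recl ffunE unlift_none; congr (_ * _).
by apply: eq_bigr => i _; rewrite ffunE liftK.
Qed.

(** * Sorting permutations and descents *)

(* Positions are numbered from 0; [desc s j] is false for j outside 0..n-2. *)
Definition desc n (s : 'S_n) (j : nat) : bool :=
  [exists i : 'I_n, exists k : 'I_n,
     [&& i == j :> nat, k == j.+1 :> nat & s k < s i]]%N.

Lemma descE n (s : 'S_n) (i k : 'I_n) :
  k = i.+1 :> nat -> desc s i = (s k < s i)%N.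
Proof.
move=> ki; apply/existsP/idP => [|lt_s].
  move=> [i' /existsP[k' /and3P[/eqP ii' /eqP kk']]].
  by rewrite (val_inj ii') (val_inj (etrans kk' (esym ki))).
by exists i; apply/existsP; exists k; rewrite eqxx ki eqxx.
Qed.

Lemma desc_last n (s : 'S_n) j : (n <= j.+1)%N -> desc s j = false.
Proof.
move=> le_nj; apply/existsP => -[i /existsP[k /and3P[_ /eqP kj _]]].
by have := ltn_ord k; rewrite kj ltnNge le_nj.
Qed.

Section Sorting.
Variable n : nat.
Implicit Types (f : 'I_n.+1 -> nat) (s : 'S_n.+1).

Definition value_order f : rel 'I_n.+1 :=
  fun x y => (f y < f x)%N || (f x == f y) && (x <= y)%N.

Definition sorts f s := sorted (value_order f) [seq s i | i <- enum 'I_n.+1].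

Lemma value_order_total f : total (value_order f).
Proof.
move=> x y; rewrite /value_order.
by case: (ltngtP (f x) (f y)) => //= _; exact: leq_total.
Qed.

Lemma value_order_trans f : transitive (value_order f).
Proof.
move=> y x z /orP[lt_yx|/andP[/eqP exy le_xy]]
  /orP[lt_zy|/andP[/eqP eyz le_yz]];
  rewrite /value_order.
- by rewrite (ltn_trans lt_zy).
- by rewrite -eyz lt_yx.
- by rewrite exy lt_zy.
- by rewrite exy eyz eqxx (leq_trans le_xy le_yz) orbT.
Qed.

Lemma value_order_anti f : antisymmetric (value_order f).
Proof.
move=> x y; rewrite /value_order; case: (ltngtP (f x) (f y)) => //= _ le_xy.
by apply/val_inj/eqP; rewrite /= eqn_leq.
Qed.

Lemma perm_image_perm s : perm_eq [seq s i | i <- enum 'I_n.+1] (enum 'I_n.+1).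
Proof.
apply: uniq_perm; rewrite ?(map_inj_uniq (@perm_inj _ s)) ?enum_uniq // => x.
by rewrite mem_enum; apply/mapP; exists (s^-1 x)%g; rewrite ?mem_enum ?permKV.
Qed.

Lemma sorts_exists f : exists s, sorts f s.
Proof.
pose w := sort (value_order f) (enum 'I_n.+1).
have szw : size w = n.+1 by rewrite size_sort size_enum_ord.
have uw : uniq w by rewrite sort_uniq enum_uniq.
have inj_w : injective (fun i : 'I_n.+1 => nth ord0 w i).
  by move=> i j /eqP; rewrite nth_uniq ?szw // => /eqP/val_inj.
exists (perm inj_w); rewrite /sorts (_ : [seq _ | i <- _] = w).
  exact: sort_sorted (@value_order_total f) _.
rewrite (eq_map (permE inj_w)); apply: (@eq_from_nth _ ord0).
  by rewrite size_map size_enum_ord.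
rewrite size_map size_enum_ord => i lt_in.
by rewrite (nth_map ord0) ?size_enum_ord // nth_enum_ord.
Qed.

Lemma sorts_inj f s s' : sorts f s -> sorts f s' -> s = s'.
Proof.
move=> ss ss'.
have : [seq s i | i <- enum 'I_n.+1] = [seq s' i | i <- enum 'I_n.+1].
  apply: sorted_eq (@value_order_trans f) (@value_order_anti f) _ _ ss ss' _.
  by rewrite (permPl (perm_image_perm s)) perm_sym perm_image_perm.
by move=> /eq_in_map eq_s; apply/permP => i; apply: eq_s; rewrite mem_enum.
Qed.

(** The gaps required before each sorted value; the first is 0 because the largest value only has to
    be at most k. *)
Definition desc_seq s : seq nat :=
  mkseq (fun i => if i is j.+1 then desc s j : nat else 0%N) n.+1.

(** As ties are broken by position, two consecutive sorted values may be equal unless [s] descends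
    there, in which case a strict drop is forced. *)
Lemma sorts_is_chain s (a : 'I_n.+1 -> nat) k : (forall i, a i <= k)%N ->
  sorts (fun x => a (s^-1 x)%g) s =
  is_chain (desc_seq s) k [seq a i | i <- enum 'I_n.+1].
Proof.
move=> le_ak; rewrite /sorts sorted_map.
have nth_e i (lt_in : (i < n.+1)%N) : nth ord0 (enum 'I_n.+1) i = Ordinal lt_in.
  by apply: val_inj; rewrite /= nth_enum_ord.
have nth_a i (lt_in : (i < n.+1)%N) :
    nth 0%N [seq a i | i <- enum 'I_n.+1] i = a (Ordinal lt_in).
  by rewrite (nth_map ord0) ?size_enum_ord // (nth_e _ lt_in).
have sz : size (desc_seq s) = size [seq a i | i <- enum 'I_n.+1].
  by rewrite size_mkseq size_map size_enum_ord.
have step (i j : 'I_n.+1) : j = i.+1 :> nat ->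
    value_order (fun x => a (s^-1 x)%g) (s i) (s j) = (a j + desc s i <= a i)%N.
  move=> ji; rewrite (descE s ji) /value_order !permK.
  have neq_s : (s i != s j :> nat).
    by apply/eqP => /val_inj/perm_inj eq_ij; move: ji; rewrite eq_ij => /n_Sn.
  rewrite [(s i <= s j)%N]leq_eqVlt (negPf neq_s) /=.
  case: (ltngtP (s i) (s j)) neq_s => //= _ _.
    by rewrite addn0 andbT orbC eq_sym -leq_eqVlt.
  by rewrite andbF orbF addn1.
apply/(sortedP ord0)/(is_chainP k sz) => [srt i|chn i].
  rewrite size_map size_enum_ord => lt_in; rewrite nth_mkseq // nth_a.
  case: i lt_in => [|i] lt_in; first by rewrite addn0.
  have lt_in' := ltnW lt_in.
  rewrite /= nth_a -(step (Ordinal lt_in') (Ordinal lt_in)) //.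
  move: (srt i); rewrite size_enum_ord => /(_ lt_in) /=.
  by rewrite (nth_e _ lt_in) (nth_e _ lt_in').
rewrite size_enum_ord => lt_in; have lt_in' := ltnW lt_in.
rewrite (nth_e _ lt_in) (nth_e _ lt_in') /=.
rewrite (step (Ordinal lt_in') (Ordinal lt_in)) //.
move: (chn i.+1); rewrite size_map size_enum_ord.
by move=> /(_ lt_in); rewrite nth_mkseq //= !nth_a.
Qed.

Lemma sum_sorts (V : nmodType) (T : finType) (v : T -> nat)
    (F : {ffun 'I_n.+1 -> T} -> V) :
  \sum_f F f =
  \sum_(s : 'S_n.+1)
    \sum_(a : {ffun 'I_n.+1 -> T} | sorts (fun x => v (a (s^-1 x)%g)) s)
      F [ffun x => a (s^-1 x)%g].
Proof.
transitivity (\sum_(f : {ffun 'I_n.+1 -> T}) \sum_(s | sorts (v \o f) s) F f).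
  apply: eq_bigr => f _; have [s sf] := sorts_exists (v \o f).
  rewrite (big_pred1 s) // => s'; apply/idP/eqP => [|-> //].
  by move=> /sorts_inj; apply.
rewrite (exchange_big_dep predT) //=; apply: eq_bigr => s _.
rewrite (reindex (fun a : {ffun 'I_n.+1 -> T} => [ffun x => a (s^-1 x)%g])) /=.
  apply: eq_bigl => a; rewrite /sorts; congr (sorted _ _).
  apply/boolp.funext => x; apply/boolp.funext => y.
  by rewrite /value_order /= !ffunE.
exists (fun f : {ffun 'I_n.+1 -> T} => [ffun x => f (s x)]) => f _;
  by apply/ffunP => x; rewrite !ffunE ?permK ?permKV.
Qed.

(** The expanded power runs over all maps from positions to {0..k}; each is counted at its unique
    sorting permutation. *)
Lemma qbracket_exp k :
  qbracket k.+1 ^+ n.+1 = \sum_s chain_sum (desc_seq s) k.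
Proof.
rewrite -[X in _ ^+ X]card_ord -prodr_const bigA_distr_bigA.
rewrite (sum_sorts (@nat_of_ord _)); apply: eq_bigr => s _.
rewrite (@chain_sumE k.+1 n.+1) ?size_mkseq //; apply: eq_big => [a|a _].
  by rewrite (@sorts_is_chain _ (fun i => a i) k) // => i; rewrite -ltnS.
by rewrite (reindex_perm s); apply: eq_bigr => i _; rewrite ffunE permK.
Qed.

Lemma carlitz :
  tseries (fun k => qbracket k.+1 ^+ n.+1) *
    \prod_(i < n.+2) (1 - t_ * q_ ^+ i) =
  \sum_(s : 'S_n.+1) \prod_(i < n.+1) (t_ * q_ ^+ i.+1) ^+ desc s i.
Proof.
have -> : tseries (fun k => qbracket k.+1 ^+ n.+1) =
          \sum_s tseries (chain_sum (desc_seq s)).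
  by rewrite -tseries_sum; apply: fpsP => k; rewrite /coefs /= qbracket_exp.
rewrite mulr_suml; apply: eq_bigr => s _.
have := tseries_chain_sum (desc_seq s); rewrite size_mkseq => ->.
(* The initial gap 0 and the absent descent at the last position let the two products, offset by
   one, match. *)
rewrite big_ord_recl nth_mkseq // expr0 mul1r.
rewrite [RHS]big_ord_recr [RHS]/= (desc_last _ (leqnn _)) expr0 mulr1.
by apply: eq_bigr => i _; rewrite lift0 nth_mkseq // ltnS.
Qed.

End Sorting.

(** * Colored permutations *)

Lemma residue_ord r (x y : 'I_r.-1.+1) : (0 < r)%N ->
  residue r ((x : nat)%:Z - (y : nat)%:Z) = (x - y : 'I_r.-1.+1).
Proof.
case: r x y => //= m x y _.
set z := x - y.
have xE : x = ((z + y) %% m.+1)%N :> nat by rewrite -[in LHS](subrK y x).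
rewrite (@residue_eq _ _ (z : nat)%:Z); last first.
  by rewrite xE -modz_nat modzDml PoszD addrK.
by rewrite /residue modz_nat absz_nat modn_small ?ltn_ord.
Qed.

(** The default value 0 of [nth] plays the part of c_(n+1), so that the last term R_r(c_n) looks
    like the others. *)
Lemma k_seqE r cs :
  k_seq r 1 cs =
  (\sum_(j < size cs) residue r ((nth 0%N cs j)%:Z - (nth 0%N cs j.+1)%:Z))%N.
Proof.
elim: cs => [|c [|c' cs] IH]; first by rewrite big_ord0.
  by rewrite big_ord1 /= subr0 divn1.
by rewrite big_ord_recl -[LHS]/(k_seq r 1 (c' :: cs) + _)%N addnC IH.
Qed.

(** The residues of the differences telescope modulo r. *)
Lemma k_seq_mod r c cs : (0 < r)%N -> (k_seq r 1 (c :: cs) = c %[mod r])%N.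
Proof.
move=> r_gt0.
have res i : (residue r i = i %[mod r])%Z.
  by rewrite /residue gez0_abs ?modz_mod // modz_ge0 // eqz_nat -lt0n.
have eqm (a b : nat) : (a = b %[mod r])%Z -> (a = b %[mod r])%N.
  by rewrite !modz_nat => -[].
elim: cs c => [|c' cs IH] c; apply: eqm; first by rewrite /= divn1 res.
rewrite -[k_seq _ _ _]/(k_seq r 1 (c' :: cs) + _)%N PoszD.
rewrite -modzDml -modzDmr res modzDmr modz_nat IH -modz_nat modzDml.
by rewrite addrC subrK.
Qed.

Section Colors.
Variables r n : nat.
Implicit Types (c : {ffun 'I_n -> 'I_r.-1.+1}) (g : Gr r n).

(* The convention c_(n+1) = 0 makes the last difference c_n.                  *)
Definition color_diff c : {ffun 'I_n -> 'I_r.-1.+1} :=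
  [ffun j : 'I_n => c j - (if insub j.+1 is Some k then c k else 0)].

(** The colors are recovered from the last one backwards. *)
Lemma color_diff_inj : injective color_diff.
Proof.
move=> c c' eq_d; apply/ffunP.
suff eq_c m (j : 'I_n) : (n - j <= m)%N -> c j = c' j.
  by move=> j; apply: (eq_c n); rewrite leq_subr.
elim: m j => [|m IH] j; first by rewrite leqn0 subn_eq0 leqNgt ltn_ord.
move=> le_njm; have := congr1 (fun d : {ffun _} => d j) eq_d; rewrite !ffunE.
case: insubP => [k _ kE|_]; last by rewrite !subr0.
rewrite (IH k) ?kE; first by move=> /addIr.
by rewrite subnS -ltnS prednK ?subn_gt0.
Qed.

Lemma mem_HDes g j :
  (j \in HDes g) = (color_diff (clr g) j == 0) && desc (prm g) j.
Proof.
rewrite inE ffunE; apply/existsP/andP => [[k /and3P[/eqP kj eq_c lt_s]]|[]].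
  rewrite (descE _ kj) lt_s; split=> //.
  rewrite insubT; first by rewrite -kj.
  move=> lt_jn; rewrite (_ : Sub _ _ = k) ?(eqP eq_c) ?subrr //.
  exact: val_inj.
case: insubP => [k _ kE|]; last by rewrite -leqNgt => /(desc_last (prm g)) ->.
rewrite subr_eq0 => eq_c; rewrite (descE _ kE) => lt_s.
by exists k; rewrite kE eqxx eq_c.
Qed.

(** For s = 1, the difference of consecutive lambdas, with 0 after the last. *)
Definition lambda_step g (j : 'I_n) : nat :=
  (r * (j \in HDes g) + color_diff (clr g) j)%N.

Lemma lambda_stat1E g i : (0 < r)%N ->
  lambda_stat 1 g i = (\sum_(j < n | i <= j) lambda_step g j)%N.
Proof.
move=> r_gt0; rewrite /lambda_stat big_split /= -big_distrr /=.
congr (_ * _ + _)%N.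
  by rewrite /h_stat cardsE -sum1_card big_mkcondl.
rewrite /k_stat k_seqE size_drop size_colors.
set F := fun j =>
  residue r ((nth 0%N (colors g) j)%:Z - (nth 0%N (colors g) j.+1)%:Z).
transitivity (\sum_(0 + i <= j < n) F j)%N.
  rewrite big_addn big_mkord; apply: eq_bigr => j _.
  by rewrite !nth_drop /F addnS [(j + i)%N]addnC.
rewrite add0n big_geq_mkord; apply: eq_bigr => j _; rewrite /F ffunE nth_colors.
rewrite -residue_ord //; congr (residue _ (_ - _%:Z)).
case: insubP => [k _ kE|]; first by rewrite -kE nth_colors.
by rewrite -leqNgt => le_nj; rewrite nth_default // size_colors.
Qed.

(** Summation by parts: the step at j occurs in the j + 1 tail sums lambda_0, .., lambda_j, and once
    in [fdes_rep]. *)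
Lemma weightE g : (0 < r)%N ->
  t_ ^+ fdes_rep 1 g * q_ ^+ fmaj_rep 1 g =
  \prod_(j < n) (t_ * q_ ^+ j.+1) ^+ lambda_step g j.
Proof.
move=> r_gt0; have -> : fdes_rep 1 g = (\sum_j lambda_step g j)%N.
  by rewrite /fdes_rep lambda_stat1E.
have -> : fmaj_rep 1 g = (\sum_(j < n) j.+1 * lambda_step g j)%N.
  rewrite /fmaj_rep; under eq_bigr do rewrite lambda_stat1E //.
  rewrite (exchange_big_dep predT) //=; apply: eq_bigr => j _.
  rewrite -(big_ord_widen n (fun=> lambda_step g j) (ltn_ord j)).
  by rewrite sum_nat_const card_ord.
rewrite -!prodrXr -big_split; apply: eq_bigr => j _ /=.
by rewrite exprMn -exprM.
Qed.

Lemma fmaj_rep_mod p g : (0 < r)%N -> (p %| r)%N ->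
  (fmaj_rep 1 g = \sum_i clr g i %[mod p])%N.
Proof.
move=> r_gt0 p_r; rewrite /fmaj_rep.
elim/big_ind2: _ => // [a b c d eq_ab eq_cd|i _].
  by rewrite -modnDm eq_ab eq_cd modnDm.
rewrite -(modn_dvdm _ p_r) -[in RHS](modn_dvdm _ p_r); congr (_ %% _)%N.
rewrite /lambda_stat mulnC modnMDl /k_stat (drop_nth 0%N) ?size_colors //.
by rewrite k_seq_mod // nth_colors.
Qed.

End Colors.

Lemma sum_Gr (V : nmodType) r n (F : Gr r n -> V) :
  \sum_g F g = \sum_(s : 'S_n) \sum_c F (ColPerm c s).
Proof.
rewrite pair_big /= (reindex (fun u => @ColPerm r n u.2 u.1)) //=.
by exists (fun g => (prm g, clr g)) => [[]|[]].
Qed.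

Lemma sum_Gr_weight r n : (0 < r)%N ->
  \sum_(g : Gr r n) t_ ^+ fdes_rep 1 g * q_ ^+ fmaj_rep 1 g =
  \sum_(s : 'S_n) \prod_(j < n)
     ((t_ * q_ ^+ j.+1) ^+ desc s j * \sum_(e < r) (t_ * q_ ^+ j.+1) ^+ e).
Proof.
move=> r_gt0; rewrite sum_Gr; apply: eq_bigr => s _.
under eq_bigr do rewrite weightE //.
pose x (j : nat) := t_ * q_ ^+ j.+1.
(* At a descent the exponent 0 is replaced by r, so the exponents run over 1..r instead of
   0..r-1. *)
pose G (j : 'I_n) (e : 'I_r.-1.+1) := x j ^+ (r * ((e == 0) && desc s j) + e).
rewrite (eq_bigr (fun c => \prod_j G j (color_diff c j))) => [|c _]; last first.
  by apply: eq_bigr => j _; rewrite /lambda_step mem_HDes.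
rewrite -(reindex_inj (@color_diff_inj r n) (P := predT)
  (F := fun d : {ffun _} => \prod_j G j (d j))).
rewrite -bigA_distr_bigA; apply: eq_bigr => j _; rewrite /G -/(x j).
case: r r_gt0 {G} => // r _ /=.
case: (desc s j); last first.
  by rewrite mul1r; apply: eq_bigr => e _; rewrite andbF muln0.
rewrite big_ord_recl [RHS](_ : _ = \sum_(e < r.+1) x j ^+ e.+1); last first.
  by rewrite mulr_sumr; apply: eq_bigr => e _; rewrite -exprS.
rewrite [RHS]big_ord_recr addrC /= muln1 addn0; congr (_ + _).
by apply: eq_bigr => e _; rewrite muln0 add0n.
Qed.

Lemma sum_Gr_series r n : (0 < r)%N ->
  tseries (fun k => qbracket k.+1 ^+ n.+1) *
    ((1 - t_) * \prod_(j < n.+1) (1 - t_ ^+ r * q_ ^+ (j.+1 * r))) =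
  \sum_(g : Gr r n.+1) t_ ^+ fdes_rep 1 g * q_ ^+ fmaj_rep 1 g.
Proof.
move=> r_gt0; rewrite sum_Gr_weight //.
transitivity (tseries (fun k => qbracket k.+1 ^+ n.+1) *
    \prod_(i < n.+2) (1 - t_ * q_ ^+ i) *
    \prod_(j < n.+1) \sum_(e < r) (t_ * q_ ^+ j.+1) ^+ e).
  rewrite (@big_ord_recl _ _ _ n.+1) expr0 mulr1 -!mulrA; congr (_ * (_ * _)).
  rewrite -big_split; apply: eq_bigr => j _.
  by rewrite lift0 /= geom_sum exprMn -exprM.
rewrite carlitz mulr_suml; apply: eq_bigr => s _.
by rewrite -big_split.
Qed.

(** * Extraction of the powers of q^p *)

Section QPart.
Variable p : nat.
Implicit Types F G : fps_tq.

Lemma coef_qpart F i j : qpart p F i j = if (p %| j)%N then F i j else 0.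
Proof. by []. Qed.

Lemma fps_tqP F G : (forall i j, F i j = G i j) -> F = G.
Proof. by move=> eqFG; apply: fpsP => i; apply: fpsP => j. Qed.

Fact qpart_zmod_morphism : zmod_morphism (qpart p).
Proof.
move=> F G; apply: fps_tqP => i j.
rewrite coef_qpart !(coef_fpsD, coef_fpsN) !coef_qpart.
by case: ifP; rewrite ?subr0.
Qed.
HB.instance Definition _ :=
  GRing.isZmodMorphism.Build fps_tq fps_tq (qpart p) qpart_zmod_morphism.

(** All q-degrees in G are multiples of p, so the q-degree of a product of terms is divisible by p
    exactly when that of the term of F is. *)
Lemma qpartM F G : qpart p G = G -> qpart p (F * G) = qpart p F * G.
Proof.
move=> qG; apply: fps_tqP => i j; rewrite coef_qpart.
have coefM (F' G' : fps_tq) : (F' * G') i j =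
    \sum_(a < i.+1) \sum_(b < j.+1) F' a b * G' (i - a)%N (j - b)%N.
  by rewrite coef_fpsM coef_fps_sum; apply: eq_bigr => a _; rewrite coef_fpsM.
have G0 a b : ~~ (p %| b)%N -> G a b = 0.
  by move=> npb; rewrite -qG coef_qpart (negPf npb).
rewrite !coefM; transitivity (\sum_(a < i.+1) \sum_(b < j.+1)
    if (p %| j)%N then F a b * G (i - a)%N (j - b)%N else 0).
  by case: ifP => // _; rewrite big1 // => a _; rewrite big1.
apply: eq_bigr => a _; apply: eq_bigr => b _; rewrite coef_qpart.
have [pjb|/G0->] := boolP (p %| j - b)%N; last by rewrite !mulr0 if_same.
have -> : (p %| j)%N = (p %| b)%N by rewrite -(dvdn_addr b pjb) subnK // -ltnS.
by case: ifP; rewrite ?mul0r.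
Qed.

Lemma qpart_monomial a b :
  qpart p (t_ ^+ a * q_ ^+ b) = if (p %| b)%N then t_ ^+ a * q_ ^+ b else 0.
Proof.
have coef_q i : (q_ ^+ b : fps_tq) i = if i == 0%N then fpsX int ^+ b else 0.
  elim: b i => [|b IH] i; first by rewrite !expr0 coef_fps1; case: eqP.
  by rewrite !exprS coef_fpsCM IH; case: eqP => // _; rewrite mulr0.
apply: fps_tqP => i j; rewrite coef_qpart.
have coef_m : (t_ ^+ a * q_ ^+ b : fps_tq) i j = ((i == a) && (j == b))%:R.
  rewrite coef_fpsXnM coef_q -[fpsX int ^+ b]mulr1.
  case: leqP => [le_ai|lt_ia]; last by rewrite ltn_eqF.
  case: eqP => [/eqP|/eqP]; rewrite subn_eq0 => le_ia.
    rewrite (eqn_leq i) le_ai le_ia /=.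
    rewrite coef_fpsXnM coef_fps1 (eqn_leq j) andbC subn_eq0.
    by case: (leqP b j) => //= _; case: leqP.
  by rewrite (eqn_leq i) (negPf le_ia).
have [pb|npb] := boolP (p %| b)%N; rewrite coef_m; first last.
  by case: ifP => // pj; case: (j =P b) pj npb => [-> ->|_ _]; rewrite ?andbF.
by case: ifPn => // npj; case: (j =P b) npj pb => [-> /negP|_]; rewrite ?andbF.
Qed.

End QPart.

Lemma qpart_series r p n : (0 < r)%N -> (p %| r)%N ->
  qpart p (tseries (fun k => qbracket k.+1 ^+ n.+1)) *
    ((1 - t_) * \prod_(j < n.+1) (1 - t_ ^+ r * q_ ^+ (j.+1 * r))) =
  \sum_(g in Grp r p n.+1) t_ ^+ fdes_rep 1 g * q_ ^+ fmaj_rep 1 g.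
Proof.
move=> r_gt0 p_r.
have qpart1 : qpart p 1 = 1.
  by have := qpart_monomial p 0 0; rewrite dvdn0 !expr0 mulr1.
have qpartS F G : qpart p F = F -> qpart p G = G -> qpart p (F * G) = F * G.
  by move=> qF qG; rewrite qpartM // qF.
rewrite -qpartM.
  rewrite sum_Gr_series // raddf_sum [RHS]big_mkcond; apply: eq_bigr => g _ /=.
  by rewrite qpart_monomial inE /dvdn fmaj_rep_mod.
apply: (qpartS _ _).
  have := qpart_monomial p 1 0; rewrite dvdn0 expr0 expr1 mulr1 => qt.
  by rewrite raddfB /= qpart1 qt.
apply: (big_ind (fun F => qpart p F = F) qpart1 qpartS) => j _.
by rewrite raddfB /= qpart1 qpart_monomial dvdn_mull.
Qed.

(** * Cosets of the scalar subgroup *)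

(** Only the last term depends on s; there c_n is divided with remainder by r/s. *)
Lemma k_seq_last r s c cs : (s %| r)%N -> (last c cs < r)%N ->
  k_seq r 1 (c :: cs) =
  (k_seq r s (c :: cs) + r %/ s * (last c cs %/ (r %/ s)))%N.
Proof.
move=> s_r; elim: cs c => [|c' cs IH] c lt_r.
  rewrite /= divn1 /residue !modz_nat !absz_nat modn_small //.
  by rewrite addnC mulnC -divn_eq.
rewrite -[k_seq r 1 _]/(k_seq r 1 (c' :: cs) + _)%N IH //.
by rewrite -[k_seq r s (c :: _)]/(k_seq r s (c' :: cs) + _)%N addnAC.
Qed.

Section Cosets.
Variables r s n : nat.
Hypotheses (r_gt0 : (0 < r)%N) (s_gt0 : (0 < s)%N) (s_dvd_r : (s %| r)%N).
Implicit Types g : Gr r n.+1.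
Local Notation w := (r %/ s)%N.
Local Notation z := (scalar_elt r s n.+1).
Local Notation C := (Cs r s n.+1).

Definition level g : nat := (clr g ord_max %/ w)%N.

Lemma lambda_stat_level g i : (i < n.+1)%N ->
  lambda_stat 1 g i = (lambda_stat s g i + w * level g)%N.
Proof.
move=> lt_in; rewrite /lambda_stat -addnA; congr (_ + _)%N.
have lastE : last 0%N (drop i (colors g)) = clr g ord_max.
  rewrite -nth_last size_drop size_colors nth_drop subSn //.
  by rewrite subnKC // -(nth_colors g ord_max).
move: lastE; rewrite /k_stat (drop_nth 0%N) ?size_colors // => lastE.
rewrite [last _ _]/= in lastE.
by rewrite (@k_seq_last r s) ?lastE // -[ltnRHS](prednK r_gt0).
Qed.

Lemma weight_level g :
  t_ ^+ fdes_rep 1 g * q_ ^+ fmaj_rep 1 g =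
  t_ ^+ fdes_rep s g * q_ ^+ fmaj_rep s g *
    (t_ ^+ w * q_ ^+ (n.+1 * w)) ^+ level g.
Proof.
rewrite /fdes_rep lambda_stat_level //.
have -> : fmaj_rep 1 g = (fmaj_rep s g + n.+1 * w * level g)%N.
  rewrite /fmaj_rep; under eq_bigr => i _ do rewrite lambda_stat_level //.
  by rewrite big_split sum_nat_const card_ord mulnA.
rewrite (exprD _ (lambda_stat s g 0)) (exprD _ (fmaj_rep s g)).
by rewrite exprMn -!exprM mulrACA.
Qed.

Lemma w_gt0 : (0 < w)%N.
Proof. by rewrite divn_gt0 // dvdn_leq. Qed.

Lemma level_lt g : (level g < s)%N.
Proof.
by rewrite ltn_divLR ?w_gt0 // mulnC divnK // -[ltnRHS](prednK r_gt0).
Qed.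

(** The generator adds w to the last color modulo r = s w. *)
Lemma level_scalar g m : level (z ^+ m * g)%g = ((level g + m) %% s)%N.
Proof.
rewrite /level scalar_eltX /= ffunE /= ffunE /= modnDmr.
rewrite [X in (_ %% X)%N](_ : _ = (s * w)%N); last first.
  by rewrite prednK // mulnC divnK.
by rewrite -modn_divl addnC divnMDl ?w_gt0 // addnC.
Qed.

Lemma scalar_elt_exp : (z ^+ s = 1)%g.
Proof.
rewrite scalar_eltX mulnC divnK //; apply: GrP => [i|] //.
by rewrite /= !ffunE; apply: val_inj; rewrite /= prednK // modnn.
Qed.

Lemma norm_Cs g : g \in 'N(C)%g.
Proof.
by apply: (subsetP (cents_norm _)) (in_setT g); rewrite centsC Cs_central.
Qed.

Lemma sum_coset_level (R : comNzRingType) (y : R) g :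
  \sum_(h in (C :* g)%g) y ^+ level h = \sum_(a < s) y ^+ a.
Proof.
(* The exponent [s - level g] brings the level to 0 modulo s, and the remaining a then brings it to
   a. *)
pose h (a : 'I_s) := (z ^+ (a + (s - level g)) * g)%g.
have lh a : level (h a) = a.
  rewrite level_scalar addnCA subnKC ?modnDr ?modn_small //.
  exact/ltnW/level_lt.
rewrite (reindex_onto h (fun g' => Ordinal (level_lt g'))) => [|g'].
  apply: eq_big => [a|a _]; last by rewrite lh.
  rewrite mem_rcoset mulgK mem_cycle /=.
  by apply/eqP/val_inj; rewrite /= lh.
case/rcosetP => _ /cycleP[m ->] ->; rewrite /h /= level_scalar.
congr (_ * _)%g; rewrite -(expg_mod _ scalar_elt_exp) modnDml.
rewrite addnAC subnKC ?modnDl ?(expg_mod _ scalar_elt_exp) //.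
exact/ltnW/level_lt.
Qed.

(** Within a coset the weight for s is constant, so [weight_level] leaves only the sum of the powers
    of y over the levels. *)
Lemma sum_Grps p : (p %| r)%N -> (p * s %| r * n.+1)%N ->
  \sum_(g in Grp r p n.+1) t_ ^+ fdes_rep 1 g * q_ ^+ fmaj_rep 1 g =
  (\sum_(x in Grps r p s n.+1) t_ ^+ fdes x * q_ ^+ fmaj x) *
    \sum_(a < s) (t_ ^+ w * q_ ^+ (n.+1 * w)) ^+ a.
Proof.
move=> p_r ps_rn; pose G := group (Grp_group_set n.+1 r_gt0 p_r).
have sCG : C \subset G by exact: Cs_sub_Grp.
rewrite (partition_big (coset C) (mem (Grps r p s n.+1))) => [|g gG] /=;
  last first.
  exact: (@mem_quotient _ _ _ G).
rewrite mulr_suml; apply: eq_bigr => x /morphimP[g Ng gG ->].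
have cosetE h :
    (h \in Grp r p n.+1) && (coset C h == coset C g) = (h \in C :* g)%g.
  rewrite -[h \in Grp _ _ _]/(h \in G); apply/andP/idP => [[_ /eqP eq_h]|hg].
    by apply/rcoset_kercosetP => //; exact: norm_Cs.
  split; last by apply/eqP/rcoset_kercosetP => //; exact: norm_Cs.
  by case/rcosetP: hg => a aC ->; rewrite groupM // (subsetP sCG).
rewrite (eq_bigl _ _ cosetE) -(sum_coset_level _ g) mulr_sumr.
apply: eq_bigr => h hg; rewrite weight_level.
have h_coset : h \in set_of_coset (coset C g) by rewrite val_coset.
by have [-> ->] := fmaj_fdesE r_gt0 s_dvd_r h_coset.
Qed.

End Cosets.

Theorem theorem5p5 (r p s n : nat)
    (r_gt0 : (0 < r)%N) (p_gt0 : (0 < p)%N) (s_gt0 : (0 < s)%N)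
    (n_gt0 : (0 < n)%N)
    (p_dvd_r : (p %| r)%N) (s_dvd_r : (s %| r)%N)
    (ps_dvd_rn : (p * s %| r * n)%N) :
  qpart p (tseries (fun k => qbracket k.+1 ^+ n)) =
  (\sum_(g in Grps r p s n) t_ ^+ fdes g * q_ ^+ fmaj g) /
  ((1 - t_) * (\prod_(1 <= i < n) (1 - t_ ^+ r * q_ ^+ (i * r))) *
   (1 - t_ ^+ (r %/ s) * q_ ^+ (n * r %/ s))).
Proof.
case: n n_gt0 ps_dvd_rn => // n _ ps_dvd_rn.
have := qpart_series n r_gt0 p_dvd_r; rewrite (sum_Grps r_gt0 s_gt0 s_dvd_r) //.
rewrite big_ord_recr /= big_add1 big_mkord -muln_divA //.
set y := t_ ^+ (r %/ s) * _; set P := \sum_(g in _) _; set D := \prod_(i < n) _.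
have -> : t_ ^+ r * q_ ^+ (n.+1 * r) = y ^+ s.
  by rewrite exprMn -!exprM -mulnA divnK.
move=> eq_qW.
have unit_t : 1 - t_ \is a GRing.unit.
  by have := @unit_1_sub_t 1 1 isT; rewrite mulr1.
have w_gt0 : (0 < r %/ s)%N by exact: w_gt0.
have unit_y : 1 - y \is a GRing.unit by exact: unit_1_sub_t.
have unit_ys : 1 - y ^+ s \is a GRing.unit.
  by rewrite exprMn -exprM unit_1_sub_t // muln_gt0 w_gt0.
have unit_D : D \is a GRing.unit.
  by apply: unitr_prod => i _; exact: unit_1_sub_t.
apply: (canRL (mulrK _)); first by rewrite !unitrM unit_t unit_D.
(* Multiplying by the unit 1 - y^s = (1 - y)(1 + y + .. + y^(s-1)) supplies the geometric sum
   present in [eq_qW]. *)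
apply: (mulIr unit_ys); rewrite -[in RHS]geom_sum [RHS]mulrCA -eq_qW.
by rewrite [RHS]mulrC !mulrA [LHS]mulrAC.
Qed.
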